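(* Let $K\in\{1,2,3\}$ and fix $\Delta x,\Delta y>0$. Let $\mathcal E=\mathcal E(\mathbf k)\in\mathbb C^{3(K+1)^2\times 3(K+1)^2}$ be the evolution matrix of the Discontinuous Galerkin method of degree $K$ for two-dimensional linear acoustics with the upwind flux, i.e. with $D_x=\mathrm{diag}(1,0,1)$ and $D_y=\mathrm{diag}(0,1,1)$. Then $$\min_{\mathbf k\in\mathbb R^2}\dim\ker\mathcal E(\mathbf k)=K^2 .$$ In particular the method is stationarity preserving.
   Context: Linear acoustics in 2D with variables $q=(u,v,p)$: $\partial_t q+J_x\partial_x q+J_y\partial_y q=0$ with $$J_x=\begin{pmatrix}0&0&1\\0&0&0\\1&0&0\end{pmatrix},\qquad J_y=\begin{pmatrix}0&0&0\\0&0&1\\0&1&0\end{pmatrix}.$$ For this system $\min_{\mathbf k}\dim\ker(J_xk_x+J_yk_y)=1$. Basis: $b_0,\dots,b_K$ is the $L^2(-\frac12,\frac12)$-orthonormal polynomial basis with $\deg b_k=k$ ($b_0=1$, $b_1=2\sqrt3x$, $b_2=\frac{\sqrt5}{2}(12x^2-1)$, $b_3=\sqrt7x(20x^2-3)$), so the mass matrix is $M^k_\alpha=\delta_{k\alpha}$. Put $G^k_\alpha=\int_{-1/2}^{1/2}b_k'(\xi)b_\alpha(\xi)\,d\xi$. Numerical fluxes: $\hat f^x(q_L,q_R)=J_x\frac{q_L+q_R}{2}-D_x\frac{q_R-q_L}{2}$, and analogously $\hat f^y$ with $J_y,D_y$; $D_x,D_y$ are $3\times3$ matrices. Evolution matrix: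 for $\mathbf k=(k_x,k_y)$ let $t_x=e^{\mathrm ik_x\Delta x}$, $t_y=e^{\mathrm ik_y\Delta y}$. Inserting $q_{ij}^{(\alpha\beta)}(t)=\hat q^{(\alpha\beta)}(t)t_x^it_y^j$ (with $\hat q^{(\alpha\beta)}\in\mathbb C^3$) in the semi-discrete DG method of tensor-product degree $K$ on the Cartesian grid with spacings $\Delta x,\Delta y$ yields $\frac{d}{dt}\hat q^{(k\ell)}+\sum_{\alpha,\beta=0}^K\mathcal E^{k\ell}_{\alpha\beta}\hat q^{(\alpha\beta)}=0$, where the $3\times3$ blocks of $\mathcal E$ are $$\begin{aligned}\mathcal E^{k\ell}_{\alpha\beta}=&-\tfrac1{\Delta x}J_xM^\ell_\beta G^k_\alpha-\tfrac1{\Delta y}J_yM^k_\alpha G^\ell_\beta\\&+\frac{b_k(\frac12)t_x-b_k(-\frac12)}{t_x\Delta x}\left(J_x\frac{b_\alpha(\frac12)+t_xb_\alpha(-\frac12)}2-D_x\frac{t_xb_\alpha(-\frac12)-b_\alpha(\frac12)}2\right)M^\ell_\beta\\&+\frac{b_\ell(\frac12)t_y-b_\ell(-\frac12)}{t_y\Delta y}\left(J_y\frac{b_\beta(\frac12)+t_yb_\beta(-\frac12)}2-D_y\frac{t_yb_\beta(-\frac12)-b_\beta(\frac12)}2\right)M^k_\alpha .\end{aligned}$$ Stationarity preserving: a linear method with $N_{\mathrm{dof}}$ degrees of freedom per cell per variable (here $N_{\mathrm{dof}}=(K+1)^2$), for a system with $\min_{\mathbf k}\dim\ker(\mathbf J\cdot\mathbf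 k)=1$, is called stationarity preserving if $1\le\min_{\mathbf k}\dim\ker\mathcal E\le N_{\mathrm{dof}}$. *)

(* Defs.v *)
From mathcomp Require Import all_boot all_order all_algebra.
From mathcomp Require Import complex.
From mathcomp Require Import all_classical all_reals all_analysis.

Set Implicit Arguments.
Unset Strict Implicit.
Unset Printing Implicit Defensive.

Import Order.TTheory GRing.Theory Num.Theory.

Local Open Scope ring_scope.
Local Open Scope complex_scope.

(* [kermx] is the kernel of the action on row vectors, hence the transpose. *)
Definition dim_ker (F : fieldType) (n : nat) (A : 'M[F]_n) : nat :=
  \rank (kermx A^T).

Lemma min_wavevector_subproof (R : realType) (f : R -> R -> nat) :
  exists n : nat, `[< exists kx ky : R, f kx ky = n >].
Proof. by exists (f 0 0); apply/asboolP; exists 0, 0. Qed.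

(* The minimum over all wave vectors (kx, ky); it is attained since the values
   are natural numbers, and [ex_minnP] gives its specification. *)
Definition min_wavevector (R : realType) (f : R -> R -> nat) : nat :=
  ex_minn (min_wavevector_subproof f).

(* Acoustics in the variables (u, v, p). *)
Definition acoustic_Jx (R : realType) : 'M[R]_3 :=
  \matrix_(i, j) (nth [::] [:: [:: 0; 0; 1];
                               [:: 0; 0; 0];
                               [:: 1; 0; 0]] i)`_j.

Definition acoustic_Jy (R : realType) : 'M[R]_3 :=
  \matrix_(i, j) (nth [::] [:: [:: 0; 0; 0];
                               [:: 0; 0; 1];
                               [:: 0; 1; 0]] i)`_j.

Definition upwind_Dx (R : realType) : 'M[R]_3 :=
  diag_mx (\row_j [:: 1; 0; 1]`_j).

Definition upwind_Dy (R : realType) : 'M[R]_3 :=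
  diag_mx (\row_j [:: 0; 1; 1]`_j).

(* Orthonormal Legendre polynomials on ]-1/2, 1/2[, up to degree 3; the value 0
   for larger indices is a dummy. *)
Definition dg_basis (R : realType) (k : nat) : {poly R} :=
  match k with
  | 0 => 1
  | 1 => (2 * Num.sqrt 3) *: 'X
  | 2 => (Num.sqrt 5 / 2) *: (12 *: 'X^2 - 1)
  | 3 => Num.sqrt 7 *: ('X * (20 *: 'X^2 - 3%:P))
  | _ => 0
  end.

Definition cell_integral (R : realType) (p : {poly R}) : R :=
  Rintegral (@lebesgue_measure R) `[- 2^-1, 2^-1]%classic (fun x => p.[x]).

Definition massM (R : realType) (k a : nat) : R :=
  cell_integral (dg_basis R k * dg_basis R a).

Definition stiffG (R : realType) (k a : nat) : R :=
  cell_integral (deriv (dg_basis R k) * dg_basis R a).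

Definition basis_right (R : realType) (k : nat) : R[i] :=
  ((dg_basis R k).[2^-1])%:C.

Definition basis_left (R : realType) (k : nat) : R[i] :=
  ((dg_basis R k).[- 2^-1])%:C.

Definition expi (R : realType) (x : R) : R[i] := cos x +i* sin x.

(* Bloch symbol, in one direction, of the boundary terms of basis function k
   acting on the coefficient a: the outer factor comes from testing with b_k at
   both faces of the cell, the inner one is the numerical flux
   J (qL + qR) / 2 - D (qR - qL) / 2 with qL = b_a(1/2), qR = t b_a(-1/2). *)
Definition face_symbol (R : realType) (m : nat) (J D : 'M[R[i]]_m)
    (h : R) (t : R[i]) (k a : nat) : 'M[R[i]]_m :=
  ((basis_right R k * t - basis_left R k) / (t * h%:C)) *:
    (((basis_right R a + t * basis_left R a) / 2) *: J
     - ((t * basis_left R a - basis_right R a) / 2) *: D).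

Definition evolution_block (R : realType) (m : nat) (Jx Jy Dx Dy : 'M[R]_m)
    (dx dy kx ky : R) (k l a b : nat) : 'M[R[i]]_m :=
  let C (A : 'M[R]_m) : 'M[R[i]]_m := map_mx (real_complex R) A in
  - ((dx^-1 * massM R l b * stiffG R k a)%:C *: C Jx)
  - ((dy^-1 * massM R k a * stiffG R l b)%:C *: C Jy)
  + (massM R l b)%:C *: face_symbol (C Jx) (C Dx) dx (expi (kx * dx)) k a
  + (massM R k a)%:C *: face_symbol (C Jy) (C Dy) dy (expi (ky * dy)) l b.

(* Degrees of freedom: (degree in x, degree in y, component of q). *)
Definition dof (K m : nat) : finType := ('I_K.+1 * 'I_K.+1 * 'I_m)%type.

Lemma card_dof (K m : nat) : #|dof K m| = (m * K.+1 ^ 2)%N.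
Proof. by rewrite !card_prod !card_ord mulnC. Qed.

Definition evolution_matrix (R : realType) (m : nat) (Jx Jy Dx Dy : 'M[R]_m)
    (K : nat) (dx dy kx ky : R) : 'M[R[i]]_#|dof K m| :=
  \matrix_(r < #|dof K m|, s < #|dof K m|)
    let: (k, l, c) := (enum_val r : dof K m) in
    let: (a, b, d) := (enum_val s : dof K m) in
    evolution_block Jx Jy Dx Dy dx dy kx ky k l a b c d.

(* Only meaningful for systems with min dim ker (J . k) = 1, which is why this
   requirement is part of the predicate. *)
Definition stationarity_preserving (R : realType) (m n : nat)
    (Jx Jy : 'M[R]_m) (Ndof : nat) (E : R -> R -> 'M[R[i]]_n) : Prop :=
  min_wavevector (fun kx ky : R => dim_ker (kx *: Jx + ky *: Jy)) = 1%N /\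
  (1 <= min_wavevector (fun kx ky : R => dim_ker (E kx ky)) <= Ndof)%N.

Definition dg_upwind_acoustics (R : realType) (K : nat) (dx dy kx ky : R) :
    'M[R[i]]_#|dof K 3| :=
  evolution_matrix (acoustic_Jx R) (acoustic_Jy R) (upwind_Dx R) (upwind_Dy R)
    K dx dy kx ky.

(* Main.v *)
(* Arrange the tensor-product coefficients of u, v, p as (K+1) x (K+1) matrices U, V, P.
   In each direction the symbol is C + S, where C (central flux) is skew-Hermitian by
   integration by parts and S = j^* j / 2, with j the jump functional, is the upwind
   dissipation. Taking the real part of <q, E q> = 0 shows that a stationary mode has
   j_x U = 0, V j_y^T = 0, j_x P = 0 and P j_y^T = 0. On functions without jumps C is the
   exact derivative D, so the kernel of E is described by these conditions together with
   D P = 0, P D^T = 0 and D U / dx + V D^T / dy = 0.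
   Imposing P = 0, no jumps and zero divergence takes (K+1)^2 + 2 (K+1) + ((K+1)^2 - 1)
   equations, because the coefficient of the divergence of top degree in both variables
   vanishes identically; hence the kernel always has dimension at least K^2. If t_x and
   t_y differ from 1, then D is injective on the functions without jumps, P vanishes, and
   a mode is determined by D U, which has degree < K in both variables; hence dimension
   at most K^2, for instance at t_x = t_y = -1. *)

Require Import Defs.
From HB Require Import structures.
From mathcomp Require Import all_boot all_order all_algebra.
From mathcomp Require Import complex.
From mathcomp Require Import all_classical all_reals all_analysis.
From mathcomp Require Import ring lra.

Set Implicit Arguments.
Unset Strict Implicit.
Unset Printing Implicit Defensive.

Import Order.TTheory GRing.Theory Num.Theory.
Import numFieldNormedType.Exports.

Local Open Scope ring_scope.

(** * Linear algebra over a numerically closed field *)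

Section KernelBounds.
Import VectorInternalTheory.
Variables (F : fieldType) (N : nat) (A : 'M[F]_N) (vT : vectType F).
Variable f : {linear 'rV[F]_N -> vT}.

Let fmx : 'M[F]_(N, dim vT) := lin1_mx (v2r \o f).

Let fmxE x : x *m fmx = v2r (f x).
Proof. exact: (mul_rV_lin1 (v2r \o f)). Qed.

(** [f] is read as [dim vT] scalar equations that suffice for membership in the kernel; rank-nullity
    bounds the dimension of their solution space. *)
Lemma kermx_rank_ge : (forall x, f x = 0 -> x *m A = 0) ->
  (N - dim vT <= \rank (kermx A))%N.
Proof.
move=> fA; have le_ker : (kermx fmx <= kermx A)%MS.
  apply/row_subP => i; apply/sub_kermxP/fA/v2r_inj.
  by rewrite -fmxE -row_mul mulmx_ker row0 linear0.
apply: leq_trans (mxrankS le_ker).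
by rewrite mxrank_ker leq_sub2l // rank_leq_col.
Qed.

(** [f] is read as coordinates that are injective on the kernel. *)
Lemma kermx_rank_le : (forall x, x *m A = 0 -> f x = 0 -> x = 0) ->
  (\rank (kermx A) <= dim vT)%N.
Proof.
move=> fA; rewrite -(mxrank_mul_ker (kermx A) fmx).
suff -> : \rank (kermx A :&: kermx fmx)%MS = 0%N by rewrite addn0 rank_leq_col.
apply/eqP; rewrite mxrank_eq0 -submx0; apply/row_subP => i.
have := row_sub i (kermx A :&: kermx fmx)%MS.
rewrite sub_capmx => /andP[/sub_kermxP kA /sub_kermxP kf].
rewrite (fA _ kA) ?sub0mx //; apply: v2r_inj.
by rewrite -fmxE kf linear0.
Qed.

End KernelBounds.

(** * Hermitian inner product on coefficient matrices *)

Section FrobeniusProduct.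
Variable C : numClosedFieldType.
Implicit Types m n p : nat.

Definition adjmx m n (A : 'M[C]_(m, n)) : 'M[C]_(n, m) := (map_mx Num.conj A)^T.

Definition dotmx m n (X Y : 'M[C]_(m, n)) : C :=
  \sum_i \sum_j (X i j)^* * Y i j.

Lemma dotmx_tr m n (X Y : 'M[C]_(m, n)) : dotmx X^T Y^T = dotmx X Y.
Proof.
rewrite /dotmx exchange_big; apply: eq_bigr => i _.
by apply: eq_bigr => j _; rewrite !mxE.
Qed.

Lemma dotmxC m n (X Y : 'M[C]_(m, n)) : dotmx Y X = (dotmx X Y)^*.
Proof.
rewrite /dotmx rmorph_sum; apply: eq_bigr => i _.
rewrite rmorph_sum; apply: eq_bigr => j _.
by rewrite rmorphM /= conjCK mulrC.
Qed.

Lemma dotmxDr m n (X Y Z : 'M[C]_(m, n)) :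
  dotmx X (Y + Z) = dotmx X Y + dotmx X Z.
Proof.
rewrite /dotmx -big_split; apply: eq_bigr => i _.
by rewrite -big_split; apply: eq_bigr => j _; rewrite !mxE mulrDr.
Qed.

Lemma dotmxZr m n (X Y : 'M[C]_(m, n)) c : dotmx X (c *: Y) = c * dotmx X Y.
Proof.
rewrite /dotmx mulr_sumr; apply: eq_bigr => i _.
by rewrite mulr_sumr; apply: eq_bigr => j _; rewrite !mxE mulrCA.
Qed.

Lemma dotmx0 m n (X : 'M[C]_(m, n)) : dotmx X 0 = 0.
Proof. by rewrite -(scale0r 0) dotmxZr mul0r. Qed.

Lemma dotmx_mul m n p (A : 'M[C]_(m, n)) (X : 'M[C]_(m, p)) Y :
  dotmx X (A *m Y) = dotmx (adjmx A *m X) Y.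
Proof.
rewrite /dotmx exchange_big [RHS]exchange_big; apply: eq_bigr => j _ /=.
under eq_bigr do rewrite mxE mulr_sumr.
rewrite exchange_big; apply: eq_bigr => k _ /=.
rewrite mxE rmorph_sum mulr_suml; apply: eq_bigr => i _.
by rewrite rmorphM /= !mxE conjCK; ring.
Qed.

Lemma dotmx_ge0 m n (X : 'M[C]_(m, n)) : 0 <= dotmx X X.
Proof.
by do 2!apply: sumr_ge0 => ? _; rewrite mulrC mul_conjC_ge0.
Qed.

Lemma dotmx_eq0 m n (X : 'M[C]_(m, n)) : dotmx X X = 0 -> X = 0.
Proof.
move=> X0; apply/matrixP => i j; rewrite mxE; apply/eqP.
have ge0 k l : 0 <= (X k l)^* * X k l by rewrite mulrC mul_conjC_ge0.
have /(_ i isT) := psumr_eq0P (fun k _ => sumr_ge0 _ (fun l _ => ge0 k l)) X0.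
move=> /(psumr_eq0P (fun l _ => ge0 i l))/(_ j isT)/eqP.
by rewrite mulrC mul_conjC_eq0.
Qed.

End FrobeniusProduct.

Lemma unimodular_neq0 (C : numClosedFieldType) (t : C) : t * t^* = 1 -> t != 0.
Proof. by apply: contra_eq_neq => ->; rewrite mul0r eq_sym oner_eq0. Qed.

Lemma unimodular_conj (C : numClosedFieldType) (t : C) : t * t^* = 1 -> t^* = t^-1.
Proof.
by move=> tt; rewrite -[LHS](mulKf (unimodular_neq0 tt)) tt mulr1.
Qed.

(** * One-dimensional symbols: jump, central flux and upwind dissipation *)

Section Symbols.
Variables (C : numClosedFieldType) (K : nat).
Variables (D : 'M[C]_K.+1) (r l : 'rV[C]_K.+1).

Definition jump (t : C) : 'rV[C]_K.+1 := t *: l - r.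

(** The factor [r - t^-1 *: l] comes from testing at the two faces, [r + t *: l] is twice the face
    average, and [D^T] is the volume term. *)
Definition central (t : C) : 'M[C]_K.+1 :=
  2^-1 *: ((r - t^-1 *: l)^T *m (r + t *: l)) - D^T.

Definition dissip (t : C) : 'M[C]_K.+1 :=
  2^-1 *: ((t^-1 *: l - r)^T *m jump t).

Lemma centralE t i j :
  central t i j = 2^-1 * ((r 0 i - t^-1 * l 0 i) * (r 0 j + t * l 0 j)) - D j i.
Proof. by rewrite !mxE big_ord1 !mxE. Qed.

Lemma dissipE t i j :
  dissip t i j = 2^-1 * ((t^-1 * l 0 i - r 0 i) * (t * l 0 j - r 0 j)).
Proof. by rewrite !mxE big_ord1 !mxE. Qed.

Lemma dissip_jump0 p t (U : 'M[C]_(K.+1, p)) : jump t *m U = 0 -> dissip t *m U = 0.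
Proof. by move=> jU; rewrite -scalemxAl -mulmxA jU mulmx0 scaler0. Qed.

(** Integration by parts on one cell, with [r] and [l] the traces of the basis at its right and left
    ends. *)
Hypothesis parts : D + D^T = r^T *m r - l^T *m l.

Let partsE i j : D i j + D j i = r 0 i * r 0 j - l 0 i * l 0 j.
Proof. by have /matrixP/(_ i j) := parts; rewrite !mxE !big_ord1 !mxE. Qed.

Lemma central_jump0 p t (U : 'M[C]_(K.+1, p)) : t != 0 ->
  jump t *m U = 0 -> central t *m U = D *m U.
Proof.
move=> t0 jU.
(* Eliminating [D^T] by [parts] leaves a correction to [D] that factors through the jump. *)
suff -> : central t = D + (2^-1 *: (r + t^-1 *: l)^T) *m jump t.
  by rewrite mulmxDl -mulmxA jU mulmx0 addr0.
apply/matrixP => i j; have := partsE i j.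
rewrite !mxE !big_ord1 !mxE => /eqP; rewrite eq_sym -subr_eq => /eqP <-.
by field.
Qed.

Hypothesis D_real : map_mx Num.conj D = D.
Hypothesis r_real : map_mx Num.conj r = r.
Hypothesis l_real : map_mx Num.conj l = l.

(** As conjugation inverts [t], the mixed terms in [r] and [l] cancel between the symbol and its
    adjoint; the pure ones cancel against [D + D^T] by [parts]. *)
Lemma adjmx_central t : t * t^* = 1 -> adjmx (central t) = - central t.
Proof.
move=> tt; have tC := unimodular_conj tt; have t0 := unimodular_neq0 tt.
apply/matrixP => i j; have := partsE i j.
have cD a b : (D a b)^* = D a b by rewrite -{2}D_real mxE.
have cr a : (r 0 a)^* = r 0 a by rewrite -{2}r_real mxE.
have cl a : (l 0 a)^* = l 0 a by rewrite -{2}l_real mxE.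
rewrite !mxE !big_ord1 !mxE.
have c2 : (2^-1 : C)^* = 2^-1 by rewrite geC0_conj // invr_ge0 ler0n.
rewrite !(rmorphM, rmorphD, rmorphN) /=.
rewrite !(cD, cr, cl, tC) c2 fmorphV /= tC invrK.
move=> /eqP; rewrite eq_sym -subr_eq => /eqP <-.
by field.
Qed.

(** On the unit circle the row [t^-1 *: l - r] is the conjugate of [jump t], so [dissip t] is half
    of the adjoint of the jump times the jump. *)
Lemma dotmx_dissip p t (U : 'M[C]_(K.+1, p)) : t * t^* = 1 ->
  dotmx U (dissip t *m U) = 2^-1 * dotmx (jump t *m U) (jump t *m U).
Proof.
move=> /unimodular_conj tC; rewrite -scalemxAl dotmxZr -mulmxA dotmx_mul.
congr (_ * dotmx (_ *m _) _).
apply/matrixP => i j; rewrite !mxE rmorphB rmorphM /= fmorphV /= tC invrK.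
by rewrite -{1}r_real -{1}l_real !mxE !conjCK.
Qed.

(** Differentiation lowers the degree by exactly one, and the basis function of degree 0 is the
    constant 1. *)
Hypothesis D_upper : forall i j : 'I_K.+1, (j <= i)%N -> D i j = 0.
Hypothesis D_superdiag : forall i j : 'I_K.+1, (j = i.+1 :> nat)%N -> D i j != 0.
Hypothesis r0 : r 0 ord0 = 1.
Hypothesis l0 : l 0 ord0 = 1.

(** A vanishing derivative leaves only constants, and a constant jumps by [t - 1] times itself. *)
Lemma mulD_jump_inj p t (U : 'M[C]_(K.+1, p)) : t != 1 ->
  jump t *m U = 0 -> D *m U = 0 -> U = 0.
Proof.
move=> t1 jU DU.
(* Descending induction on the degree [i]: row [i.-1] of [D *m U = 0] involves only row [i] and rows
   of higher degree, which vanish already. *)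
have U0 : forall d (i : 'I_K.+1) j, (K - i = d)%N -> (0 < i)%N -> U i j = 0.
  elim/ltn_ind => d IH i j id i0.
  have i1 : (i.-1 < K.+1)%N by rewrite (leq_ltn_trans (leq_pred _)).
  pose i' : 'I_K.+1 := Ordinal i1.
  have /matrixP/(_ i' j) := DU; rewrite !mxE (bigD1 i) //= big1.
    move/eqP; rewrite addr0 mulf_eq0 (negPf (@D_superdiag i' i _)) //=; last by rewrite prednK.
    by move/eqP.
  move=> k ki; have [ltik | leki] := ltnP i k.
    rewrite (IH (K - k)%N _ k) ?mulr0 //; last exact: ltn_trans ltik.
    by rewrite -id ltn_sub2l // (leq_trans ltik) // -ltnS.
  rewrite D_upper ?mul0r //= -ltnS prednK // ltn_neqAle leki andbT.
  by apply: contra ki => /eqP/val_inj ->.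
apply/matrixP => i j; rewrite [RHS]mxE; have [i0|] := posnP i; last exact: U0.
have /matrixP/(_ 0 j) := jU; rewrite !mxE (bigD1 ord0) //= big1 => [|k k0].
  rewrite addr0 !mxE r0 l0 mulr1 => /eqP; rewrite mulf_eq0 subr_eq0 (negPf t1) /=.
  by move=> /eqP Uj; rewrite -Uj; congr (U _ _); apply: val_inj.
by rewrite (U0 (K - k)%N) ?mulr0 // lt0n.
Qed.

Lemma mulD_last p (U : 'M[C]_(K.+1, p)) j : (D *m U) ord_max j = 0.
Proof. by rewrite mxE big1 // => k _; rewrite D_upper ?mul0r // -ltnS. Qed.

(** * Stationary modes of the two-dimensional system *)

Section Acoustics.
Variables (a b tx ty : C) (U V P : 'M[C]_K.+1).

(* The x-operators act on the coefficient matrices by left multiplication, the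
   y-operators by right multiplication with their transpose. *)
Definition acoustic_steady : Prop :=
  [/\ a *: (central tx *m P + dissip tx *m U) = 0,
      b *: (P *m (central ty)^T + V *m (dissip ty)^T) = 0
    & a *: (central tx *m U + dissip tx *m P)
      + b *: (V *m (central ty)^T + P *m (dissip ty)^T) = 0].

Hypotheses (txU : tx * tx^* = 1) (tyU : ty * ty^* = 1).
Hypotheses (a0 : 0 < a) (b0 : 0 < b).

Let dot_central t p (X Y : 'M[C]_(K.+1, p)) : t * t^* = 1 ->
  dotmx X (central t *m Y) = - (dotmx Y (central t *m X))^*.
Proof.
move=> tt; rewrite dotmx_mul adjmx_central // dotmxC mulNmx -scaleN1r.
by rewrite dotmxZr mulN1r rmorphN.
Qed.

(** Energy argument: each equation is paired with its own unknown, and the skew-Hermitian cross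
    terms are eliminated. *)
Lemma steady_jump0 : acoustic_steady ->
  [/\ jump tx *m U = 0, V *m (jump ty)^T = 0,
      jump tx *m P = 0 & P *m (jump ty)^T = 0].
Proof.
case=> stU stV stP.
have := congr1 (dotmx U) stU; have := congr1 (dotmx V) stV.
have := congr1 (dotmx P) stP.
(* Transposition turns the y-operators into left multiplications, so the one-dimensional lemmas
   serve both directions. *)
have trE t X : X *m (central t)^T = (central t *m X^T)^T by rewrite trmx_mul trmxK.
have trE' t X : X *m (dissip t)^T = (dissip t *m X^T)^T by rewrite trmx_mul trmxK.
have dtr (X Y : 'M[C]_K.+1) : dotmx X Y^T = dotmx X^T Y by rewrite -dotmx_tr trmxK.
rewrite !trE !trE' !(dotmxDr, dotmxZr, dotmx0) !dtr !dotmx_dissip //.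
rewrite (dot_central U P txU) (dot_central V^T P^T tyU).
set z1 := dotmx P _; set z2 := dotmx P^T _.
set s1 := dotmx (_ *m U) _; set s2 := dotmx (_ *m V^T) _.
set s3 := dotmx (_ *m P) _; set s4 := dotmx (_ *m P^T) _.
move=> e3 e2 e1.
have s1C : s1^* = s1 by rewrite /s1 -dotmxC.
have s2C : s2^* = s2 by rewrite /s2 -dotmxC.
have s3C : s3^* = s3 by rewrite /s3 -dotmxC.
have s4C : s4^* = s4 by rewrite /s4 -dotmxC.
have [s1p s2p s3p s4p] : [/\ 0 <= s1, 0 <= s2, 0 <= s3 & 0 <= s4].
  by split; exact: dotmx_ge0.
have c2 : (2^-1 : C)^* = 2^-1 by rewrite geC0_conj // invr_ge0 ler0n.
(* The velocity equations express the cross terms by the velocity dissipation. *)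
have z1E : z1 = 2^-1 * s1.
  move: e1 => /eqP; rewrite mulf_eq0 gt_eqF //= addrC subr_eq0 => /eqP.
  by move/(congr1 Num.conj); rewrite conjCK rmorphM /= c2 s1C => ->.
have z2E : z2 = 2^-1 * s2.
  move: e2 => /eqP; rewrite mulf_eq0 gt_eqF //= addrC subr_eq0 => /eqP.
  by move/(congr1 Num.conj); rewrite conjCK rmorphM /= c2 s2C => ->.
(* Inserted in the pressure equation, they leave a vanishing sum of nonnegative terms with positive
   weights. *)
have sum0 : (a * s1 + a * s3) + (b * s2 + b * s4) = 0.
  by rewrite -(mulr0 2) -e3 z1E z2E; field.
have [age0 bge0] := (ltW a0, ltW b0).
move/eqP: sum0; rewrite !paddr_eq0 ?addr_ge0 ?mulr_ge0 //.
rewrite !mulf_eq0 (gt_eqF a0) (gt_eqF b0) /= => /andP[/andP[/eqP/dotmx_eq0 jU /eqP/dotmx_eq0 jP]].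
move=> /andP[/eqP/dotmx_eq0 jV /eqP/dotmx_eq0 jPy].
by split=> //; apply: trmx_inj; rewrite trmx_mul trmxK trmx0.
Qed.

(** Without jumps the dissipation vanishes and the central flux is exact differentiation;
    [steady_jump0] provides the absence of jumps. *)
Lemma steadyP : acoustic_steady <->
  [/\ [/\ jump tx *m U = 0, V *m (jump ty)^T = 0,
          jump tx *m P = 0 & P *m (jump ty)^T = 0],
      D *m P = 0, P *m D^T = 0 & a *: (D *m U) + b *: (V *m D^T) = 0].
Proof.
have cy X : X *m (jump ty)^T = 0 -> X *m (central ty)^T = X *m D^T.
  move=> /(congr1 trmx); rewrite trmx_mul trmxK trmx0 => jX; apply: trmx_inj.
  by rewrite !trmx_mul !trmxK central_jump0 // unimodular_neq0.
have dy X : X *m (jump ty)^T = 0 -> X *m (dissip ty)^T = 0.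
  move=> /(congr1 trmx); rewrite trmx_mul trmxK trmx0 => jX; apply: trmx_inj.
  by rewrite trmx_mul trmxK trmx0 dissip_jump0.
have tx0 := unimodular_neq0 txU.
split=> [st | [[jU jV jP jPy] DP PD DUV]].
  have [jU jV jP jPy] := steady_jump0 st; split=> //; case: st; last first.
  - by rewrite !(central_jump0 tx0) // !dissip_jump0 // !cy // !dy // !addr0.
  - rewrite cy // dy // addr0 => _ /eqP; rewrite scaler_eq0 gt_eqF //=.
    by move=> /eqP.
  rewrite central_jump0 // dissip_jump0 // addr0 => /eqP.
  by rewrite scaler_eq0 gt_eqF //= => /eqP.
split; rewrite ?(central_jump0 tx0) // ?dissip_jump0 // ?cy // ?dy // ?addr0 //.
  by rewrite DP scaler0.
by rewrite PD scaler0.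
Qed.

Let mul_trD_last (X : 'M[C]_K.+1) i : (X *m D^T) i ord_max = 0.
Proof. by have := mulD_last X^T i; rewrite -[D *m _]trmxK trmx_mul trmxK mxE. Qed.

Let splitmax (i : 'I_K.+1) :
  (exists k : 'I_K, i = widen_ord (leqnSn K) k) \/ i = ord_max.
Proof.
have [iK | Ki] := ltnP i K; [left; exists (Ordinal iK) | right]; apply: val_inj => //=.
by apply/eqP; rewrite eqn_leq Ki -ltnS ltn_ord.
Qed.

Lemma steady_corner_eq0 : tx != 1 -> ty != 1 -> acoustic_steady ->
  mxsub (widen_ord (leqnSn K)) (widen_ord (leqnSn K)) (D *m U) = 0 ->
  [/\ U = 0, V = 0 & P = 0].
Proof.
move=> tx1 ty1 /steadyP[[jU jV jP _] DP _ DUV] DU0.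
have DU : D *m U = 0.
  apply/matrixP => i j; rewrite [RHS]mxE.
  case: (splitmax i) => [[i' ->] | ->]; last exact: mulD_last.
  case: (splitmax j) => [[j' ->] | ->].
    by move/matrixP/(_ i' j'): DU0; rewrite !mxE.
  (* [V *m D^T] has no entries of top y-degree, so the divergence equation kills the last column of
     [D *m U]. *)
  move/matrixP/(_ (widen_ord (leqnSn K) i') ord_max): DUV.
  rewrite mxE [X in X + _]mxE [X in _ + X]mxE mul_trD_last mulr0 addr0 [RHS]mxE.
  by move/eqP; rewrite mulf_eq0 gt_eqF //= => /eqP.
split; [exact: (mulD_jump_inj tx1 jU DU) | | exact: (mulD_jump_inj tx1 jP DP)].
move/eqP: DUV; rewrite DU scaler0 add0r scaler_eq0 gt_eqF //= => /eqP VD.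
apply: trmx_inj; rewrite trmx0; apply: (mulD_jump_inj ty1).
  by rewrite -[jump _]trmxK -trmx_mul jV trmx0.
by rewrite -[D]trmxK -trmx_mul VD trmx0.
Qed.

(* The entry (K, K) of the divergence vanishes identically, hence is not imposed. *)
Lemma steady_of_constraints :
  P = 0 -> jump tx *m U = 0 -> V *m (jump ty)^T = 0 ->
  let W := a *: (D *m U) + b *: (V *m D^T) in
  colsub (widen_ord (leqnSn K)) W = 0 ->
  rowsub (widen_ord (leqnSn K)) (col ord_max W) = 0 -> acoustic_steady.
Proof.
move=> P0 jU jV W W1 W2; apply/steadyP; rewrite P0 !mulmx0 !mul0mx; split=> //.
apply/matrixP => i j; rewrite [RHS]mxE.
case: (splitmax j) => [[j' ->] | ->].
  by move/matrixP/(_ i j'): W1; rewrite mxE => ->; rewrite mxE.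
case: (splitmax i) => [[i' ->] | ->].
  by move/matrixP/(_ i' 0): W2; rewrite !mxE.
rewrite mxE [X in X + _]mxE [X in _ + X]mxE mulD_last mul_trD_last.
by rewrite !mulr0 addr0.
Qed.
End Acoustics.
End Symbols.

Local Open Scope complex_scope.

(** * The Legendre basis *)

Section Basis.
Variable R : realType.
Implicit Types (p q : {poly R}) (k a : nat).

Let hornE := (hornerM, hornerD, hornerN, hornerZ, hornerX, hornerXn, hornerC,
  horner_cons, horner0).

Lemma cell_integral_deriv p : cell_integral p^`() = p.[2^-1] - p.[- 2^-1].
Proof.
rewrite /cell_integral /Rintegral (@continuous_FTC2 _ _ (horner p)) //.
- lra.
- by apply: continuous_subspaceT => x; exact: continuous_horner.
- split=> [x _ | |]; first exact: derivable_horner.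
  + by apply: cvg_at_right_filter; exact: continuous_horner.
  + by apply: cvg_at_left_filter; exact: continuous_horner.
- by move=> x _; rewrite -derivE.
Qed.

(** Products of two basis polynomials have degree at most 6; odd powers integrate to 0 on the
    symmetric cell, and the even ones give 1, 1/12, 1/80, 1/448. *)
Lemma cell_integral_deg6 p c0 c1 c2 c3 c4 c5 c6 :
  (forall x, p.[x] = c0 + c1 * x + c2 * x ^+ 2 + c3 * x ^+ 3 + c4 * x ^+ 4
                     + c5 * x ^+ 5 + c6 * x ^+ 6) ->
  cell_integral p = c0 + c2 / 12 + c4 / 80 + c6 / 448.
Proof.
move=> pE.
(* The antiderivative of [p] vanishing at 0. *)
pose P : {poly R} := Poly [:: 0; c0; c1 / 2; c2 / 3; c3 / 4; c4 / 5; c5 / 6; c6 / 7].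
have PE x : P.[x] = c0 * x + c1 / 2 * x ^+ 2 + c2 / 3 * x ^+ 3 + c3 / 4 * x ^+ 4
    + c4 / 5 * x ^+ 5 + c5 / 6 * x ^+ 6 + c6 / 7 * x ^+ 7.
  by rewrite horner_Poly /=; ring.
have dPE x : P^`().[x] = p.[x].
  by rewrite pE /P /= !cons_poly_def !poly.derivE; rewrite !hornE; field.
have -> : cell_integral p = cell_integral P^`().
  by congr (Rintegral _ _ _); apply/funext => x; rewrite dPE.
by rewrite cell_integral_deriv !PE; field.
Qed.

Lemma stiffG_parts k a :
  stiffG R k a + stiffG R a k
  = (dg_basis R k).[2^-1] * (dg_basis R a).[2^-1]
    - (dg_basis R k).[- 2^-1] * (dg_basis R a).[- 2^-1].
Proof.
rewrite -!hornerM -cell_integral_deriv derivM [X in _ = cell_integral (_ + X)]mulrC.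
rewrite /stiffG /cell_integral -RintegralD //; last 2 first.
- by apply: continuous_compact_integrable; [exact: segment_compact |
    apply: continuous_subspaceT => x; exact: continuous_horner].
- by apply: continuous_compact_integrable; [exact: segment_compact |
    apply: continuous_subspaceT => x; exact: continuous_horner].
by congr (Rintegral _ _ _); apply/funext => x; rewrite hornerD.
Qed.

Let s3 : R := Num.sqrt 3.
Let s5 : R := Num.sqrt 5.
Let s7 : R := Num.sqrt 7.

Lemma massM_eq k a : (k < 4)%N -> (a < 4)%N -> massM R k a = (k == a)%:R.
Proof.
wlog ka : k a / (k <= a)%N => [hw k4 a4 |].
  have [|/ltnW] := leqP k a => ka; first exact: hw.
  by rewrite eq_sym -hw // /massM mulrC.
have q3 : s3 ^+ 2 = 3 by rewrite sqr_sqrtr.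
have q5 : s5 ^+ 2 = 5 by rewrite sqr_sqrtr.
have q7 : s7 ^+ 2 = 7 by rewrite sqr_sqrtr.
rewrite /massM; case: k a ka => [|[|[|[|//]]]] [|[|[|[|//]]]] //= _ _ _;
  rewrite /dg_basis -/s3 -/s5 -/s7.
(* In each case the seven arguments are the coefficients of the product of the two basis
   polynomials, by increasing degree. *)
- rewrite (@cell_integral_deg6 _ 1 0 0 0 0 0 0); first by field.
  by move=> x; rewrite !hornE; field.
- rewrite (@cell_integral_deg6 _ 0 (2 * s3) 0 0 0 0 0); first by field.
  by move=> x; rewrite !hornE; field.
- rewrite (@cell_integral_deg6 _ (- s5/2) 0 (6 * s5) 0 0 0 0); first by field.
  by move=> x; rewrite !hornE; field.
- rewrite (@cell_integral_deg6 _ 0 (- 3 * s7) 0 (20 * s7) 0 0 0); first by field.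
  by move=> x; rewrite !hornE; field.
- rewrite (@cell_integral_deg6 _ 0 0 (4 * s3 ^+ 2) 0 0 0 0); first by rewrite q3; field.
  by move=> x; rewrite !hornE; field.
- rewrite (@cell_integral_deg6 _ 0 (- s3 * s5) 0 (12 * s3 * s5) 0 0 0); first by field.
  by move=> x; rewrite !hornE; field.
- rewrite (@cell_integral_deg6 _ 0 0 (- 6 * s3 * s7) 0 (40 * s3 * s7) 0 0); first by field.
  by move=> x; rewrite !hornE; field.
- rewrite (@cell_integral_deg6 _ (s5 ^+ 2 / 4) 0 (- 6 * s5 ^+ 2) 0 (36 * s5 ^+ 2) 0 0);
    first by rewrite q5; field.
  by move=> x; rewrite !hornE; field.
- rewrite (@cell_integral_deg6 _ 0 (3/2 * s5 * s7) 0 (- 28 * s5 * s7) 0 (120 * s5 * s7) 0);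
    first by field.
  by move=> x; rewrite !hornE; field.
- rewrite (@cell_integral_deg6 _ 0 0 (9 * s7 ^+ 2) 0 (- 120 * s7 ^+ 2) 0 (400 * s7 ^+ 2));
    first by rewrite q7; field.
  by move=> x; rewrite !hornE; field.
Qed.

(** The derivative of [b_k] has degree below [k], hence is orthogonal to [b_a]; here this is checked
    case by case from the coefficients. *)
Lemma stiffG_lower k a : (k < 4)%N -> (a < 4)%N -> (k <= a)%N -> stiffG R k a = 0.
Proof.
rewrite /stiffG; case: k a => [|[|[|[|//]]]] [|[|[|[|//]]]] //= _ _ _;
  rewrite /dg_basis -/s3 -/s5 -/s7.
1-4: by rewrite (@cell_integral_deg6 _ 0 0 0 0 0 0 0);
  [field | move=> x; rewrite !poly.derivE !hornE; field].
- rewrite (@cell_integral_deg6 _ 0 (4 * s3 ^+ 2) 0 0 0 0 0); first by field.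
  by move=> x; rewrite !poly.derivE !hornE; field.
- rewrite (@cell_integral_deg6 _ (- s3 * s5) 0 (12 * s3 * s5) 0 0 0 0); first by field.
  by move=> x; rewrite !poly.derivE !hornE; field.
- rewrite (@cell_integral_deg6 _ 0 (- 6 * s3 * s7) 0 (40 * s3 * s7) 0 0 0); first by field.
  by move=> x; rewrite !poly.derivE !hornE; field.
- rewrite (@cell_integral_deg6 _ 0 (- 6 * s5 ^+ 2) 0 (72 * s5 ^+ 2) 0 0 0); first by field.
  by move=> x; rewrite !poly.derivE !hornE; field.
- rewrite (@cell_integral_deg6 _ 0 0 (- 36 * s5 * s7) 0 (240 * s5 * s7) 0 0); first by field.
  by move=> x; rewrite !poly.derivE !hornE; field.
- rewrite (@cell_integral_deg6 _ 0 (9 * s7 ^+ 2) 0 (- 240 * s7 ^+ 2) 0 (1200 * s7 ^+ 2) 0);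
    first by field.
  by move=> x; rewrite !poly.derivE !hornE; field.
Qed.

(** The value is [k + 1] times the quotient of the leading coefficients of [b_(k+1)] and [b_k]:
    [2 * s3], [2 * s3 * s5] and [2 * s5 * s7]. *)
Lemma stiffG_subdiag_neq0 k : (k < 3)%N -> stiffG R k.+1 k != 0.
Proof.
have s3n0 : s3 != 0 by rewrite sqrtr_eq0 -ltNge.
have s5n0 : s5 != 0 by rewrite sqrtr_eq0 -ltNge.
have s7n0 : s7 != 0 by rewrite sqrtr_eq0 -ltNge.
rewrite /stiffG; case: k => [|[|[|//]]] _; rewrite /dg_basis -/s3 -/s5 -/s7.
- rewrite (@cell_integral_deg6 _ (2 * s3) 0 0 0 0 0 0); last first.
    by move=> x; rewrite !poly.derivE !hornE; field.
  suff -> : 2 * s3 + 0 / 12 + 0 / 80 + 0 / 448 = 2 * s3 by rewrite mulf_neq0.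
  by field.
- rewrite (@cell_integral_deg6 _ 0 0 (24 * s3 * s5) 0 0 0 0); last first.
    by move=> x; rewrite !poly.derivE !hornE; field.
  suff -> : 0 + 24 * s3 * s5 / 12 + 0 / 80 + 0 / 448 = 2 * s3 * s5.
    by rewrite !mulf_neq0.
  by field.
- rewrite (@cell_integral_deg6 _ (3/2 * s5 * s7) 0 (- 48 * s5 * s7) 0 (360 * s5 * s7) 0 0);
    last first.
    by move=> x; rewrite !poly.derivE !hornE; field.
  suff -> : 3 / 2 * s5 * s7 + - 48 * s5 * s7 / 12 + 360 * s5 * s7 / 80 + 0 / 448
            = 2 * s5 * s7 by rewrite !mulf_neq0.
  by field.
Qed.

End Basis.

(** * The Discontinuous Galerkin evolution matrix *)

Section DGOperators.
Variable R : realType.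
Local Notation C := R[i].

Lemma expi_unimodular (x : R) : expi x * Num.conj (expi x) = 1.
Proof.
rewrite /expi -[Num.conj _]/(conjc _) /=; apply/eqP; rewrite eq_complex /=.
by have := cos2Dsin2 x; rewrite !expr2 => <-; apply/andP; split; apply/eqP; ring.
Qed.

Lemma conj_real_complex (x : R) : Num.conj x%:C = x%:C.
Proof. by rewrite -[Num.conj _]/(conjc _) /= oppr0. Qed.

Variable K : nat.
Hypothesis K4 : (K < 4)%N.

(** The indices are swapped: by orthonormality, column [j] holds the coefficients of the derivative
    of [b_j]. *)
Definition dg_deriv : 'M[C]_K.+1 := \matrix_(i, j) (stiffG R j i)%:C.
Definition dg_right : 'rV[C]_K.+1 := \row_j basis_right R j.
Definition dg_left : 'rV[C]_K.+1 := \row_j basis_left R j.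

Let lt4 (i : 'I_K.+1) : (i < 4)%N.
Proof. by rewrite (leq_trans (ltn_ord i)). Qed.

Lemma dg_deriv_parts : dg_deriv + dg_deriv^T
  = dg_right^T *m dg_right - dg_left^T *m dg_left.
Proof.
apply/matrixP => i j; rewrite !mxE !big_ord1 !mxE /basis_right /basis_left.
by rewrite -!rmorphM -rmorphB -rmorphD /= addrC stiffG_parts.
Qed.

Lemma dg_deriv_real : map_mx Num.conj dg_deriv = dg_deriv.
Proof. by apply/matrixP => i j; rewrite !mxE conj_real_complex. Qed.

Lemma dg_right_real : map_mx Num.conj dg_right = dg_right.
Proof. by apply/matrixP => i j; rewrite !mxE conj_real_complex. Qed.

Lemma dg_left_real : map_mx Num.conj dg_left = dg_left.
Proof. by apply/matrixP => i j; rewrite !mxE conj_real_complex. Qed.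

Lemma dg_deriv_upper (i j : 'I_K.+1) : (j <= i)%N -> dg_deriv i j = 0.
Proof. by move=> ji; rewrite mxE stiffG_lower. Qed.

Lemma dg_deriv_superdiag (i j : 'I_K.+1) : j = i.+1 :> nat -> dg_deriv i j != 0.
Proof.
move=> ji; rewrite mxE fmorph_eq0 ji stiffG_subdiag_neq0 //.
by rewrite -ltnS -ji.
Qed.

Lemma dg_right0 : dg_right 0 ord0 = 1.
Proof. by rewrite mxE /basis_right /= hornerC. Qed.

Lemma dg_left0 : dg_left 0 ord0 = 1.
Proof. by rewrite mxE /basis_left /= hornerC. Qed.

End DGOperators.

(** * Tensor-product form of the evolution matrix *)

Definition dof_component (F : fieldType) (K m : nat) (x : 'rV[F]_#|dof K m|)
    (d : 'I_m) : 'M[F]_K.+1 :=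
  \matrix_(i, j) x 0 (enum_rank ((i, j, d) : dof K m)).

Lemma evolution_matrixE (R : realType) m (Jx Jy Dx Dy : 'M[R]_m) K
    (dx dy kx ky : R) (k l a b : 'I_K.+1) (c d : 'I_m) :
  evolution_matrix Jx Jy Dx Dy K dx dy kx ky
    (enum_rank ((k, l, c) : dof K m)) (enum_rank ((a, b, d) : dof K m))
  = evolution_block Jx Jy Dx Dy dx dy kx ky k l a b c d.
Proof. by rewrite mxE !enum_rankK. Qed.

(* Stated for abstract scalars: unfolding entries with [mxE] directly in
   [evolution_block] makes unification run through the cell integrals. *)
Lemma symbol_entry (F G : fieldType) (f : F -> G) m (A B A' B' : 'M[F]_m)
    (x y u v z1 z2 z3 w1 w2 w3 : G) i j :
  (- (x *: map_mx f A) - y *: map_mx f B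
   + u *: (z1 *: (z2 *: map_mx f A - z3 *: map_mx f A'))
   + v *: (w1 *: (w2 *: map_mx f B - w3 *: map_mx f B'))) i j
  = - (x * f (A i j)) - y * f (B i j) + u * (z1 * (z2 * f (A i j) - z3 * f (A' i j)))
    + v * (w1 * (w2 * f (B i j) - w3 * f (B' i j))).
Proof. by rewrite !mxE. Qed.

(** Orthonormality makes the evolution matrix a Kronecker sum: the x-terms keep the y-degree and act
    from the left, the y-terms keep the x-degree and act from the right. *)
Lemma mulmx_evolution (R : realType) m (Jx Jy Dx Dy : 'M[R]_m) K
  (K4 : (K < 4)%N) (dx dy kx ky : R) (x : 'rV[R[i]]_#|dof K m|) (k l : 'I_K.+1) (c : 'I_m) :
  dx != 0 -> dy != 0 ->
  let X := dof_component x in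
  let J (A : 'M[R]_m) c d := (A c d)%:C in
  let Cx := central (dg_deriv R K) (dg_right R K) (dg_left R K) (expi (kx * dx)) in
  let Cy := central (dg_deriv R K) (dg_right R K) (dg_left R K) (expi (ky * dy)) in
  let Sx := dissip (dg_right R K) (dg_left R K) (expi (kx * dx)) in
  let Sy := dissip (dg_right R K) (dg_left R K) (expi (ky * dy)) in
  (x *m (evolution_matrix Jx Jy Dx Dy K dx dy kx ky)^T) 0 (enum_rank ((k, l, c) : dof K m))
  = \sum_d ((dx^-1)%:C * (J Jx c d * (Cx *m X d) k l + J Dx c d * (Sx *m X d) k l)
   + (dy^-1)%:C * (J Jy c d * (X d *m Cy^T) k l + J Dy c d * (X d *m Sy^T) k l)).
Proof.
move=> dx0 dy0 X J Cx Cy Sx Sy.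
have tx0 := unimodular_neq0 (expi_unimodular (kx * dx)).
have ty0 := unimodular_neq0 (expi_unimodular (ky * dy)).
have dxC0 : dx%:C != 0 :> R[i] by rewrite fmorph_eq0.
have dyC0 : dy%:C != 0 :> R[i] by rewrite fmorph_eq0.
have lt4 (i : 'I_K.+1) : (i < 4)%N by rewrite (leq_trans (ltn_ord i)).
have CE t (i j : 'I_K.+1) : central (dg_deriv R K) (dg_right R K) (dg_left R K) t i j
   = 2^-1 * ((basis_right R i - t^-1 * basis_left R i) * (basis_right R j + t * basis_left R j))
     - (stiffG R i j)%:C.
  by rewrite centralE ![_ (dg_right _ _) _ _]mxE ![_ (dg_left _ _) _ _]mxE mxE.
have SE t (i j : 'I_K.+1) : dissip (dg_right R K) (dg_left R K) t i j
   = 2^-1 * ((t^-1 * basis_left R i - basis_right R i) * (t * basis_left R j - basis_right R j)).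
  by rewrite dissipE ![_ (dg_right _ _) _ _]mxE ![_ (dg_left _ _) _ _]mxE.
have CxE := CE (expi (kx * dx)); have SxE := SE (expi (kx * dx)).
have CyE := CE (expi (ky * dy)); have SyE := SE (expi (ky * dy)).
rewrite -/Cx -/Sx in CxE SxE; rewrite -/Cy -/Sy in CyE SyE.
clearbody Cx Cy Sx Sy.
have blockE (a b : 'I_K.+1) d : evolution_block Jx Jy Dx Dy dx dy kx ky k l a b c d
  = (l == b)%:R * ((dx^-1)%:C * (J Jx c d * Cx k a + J Dx c d * Sx k a))
    + (k == a)%:R * ((dy^-1)%:C * (J Jy c d * Cy l b + J Dy c d * Sy l b)).
  rewrite /evolution_block /face_symbol symbol_entry !massM_eq // !(inj_eq val_inj).
  rewrite CxE CyE SxE SyE /J.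
  move: (stiffG R k a) (stiffG R l b) => g1 g2.
  move: (basis_right R k) (basis_left R k) (basis_right R a) (basis_left R a) => r1 l1 r2 l2.
  move: (basis_right R l) (basis_left R l) (basis_right R b) (basis_left R b) => r3 l3 r4 l4.
  move: tx0 ty0; move: (expi _) (expi _) => tx ty tx0 ty0.
  rewrite !rmorphM /= !rmorph_nat !fmorphV.
  have [_|_] := eqVneq l b; have [_|_] := eqVneq k a; field;
    rewrite ?tx0 ?ty0 ?dxC0 ?dyC0 //.
rewrite mxE (reindex enum_rank) /=; last exact/onW_bij/enum_rank_bij.
rewrite (eq_bigr (fun s : dof K m => X s.2 s.1.1 s.1.2
  * evolution_block Jx Jy Dx Dy dx dy kx ky k l s.1.1 s.1.2 c s.2)); last first.
  by case=> [[a b] d] _; rewrite [_^T _ _]mxE evolution_matrixE [X _ _ _]mxE.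
clearbody X.
rewrite -(pair_bigA _ (fun s d => X d s.1 s.2
  * evolution_block Jx Jy Dx Dy dx dy kx ky k l s.1 s.2 c d)) /=.
rewrite exchange_big; apply: eq_bigr => d _ /=.
rewrite -(pair_bigA _ (fun a b => X d a b
  * evolution_block Jx Jy Dx Dy dx dy kx ky k l a b c d)) /=.
under eq_bigr do under eq_bigr do rewrite blockE mulrDr.
under eq_bigr do rewrite big_split /=.
(* The Kronecker delta in the y-degree collapses the sum over [b]; in the other half the one in the
   x-degree collapses the sum over [a]. *)
rewrite big_split /=; congr (_ + _).
  rewrite !mxE !mulr_sumr -big_split mulr_sumr; apply: eq_bigr => a _ /=.
  rewrite (bigD1 l) //= eqxx big1 => [|b bl]; last by rewrite eq_sym (negPf bl) mul0r mulr0.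
  by rewrite addr0 -[true%:R]/1; ring.
rewrite exchange_big !mxE !mulr_sumr -big_split mulr_sumr; apply: eq_bigr => b _ /=.
rewrite (bigD1 k) //= eqxx big1 => [|a ak]; last by rewrite eq_sym (negPf ak) mul0r mulr0.
by rewrite addr0 -[true%:R]/1 ![_^T _ _]mxE; ring.
Qed.

(** * Dimension of the kernel *)

Lemma min_wavevector_eq (R : realType) (f : R -> R -> nat) n :
  (forall kx ky, n <= f kx ky)%N -> (exists kx ky, f kx ky <= n)%N ->
  min_wavevector f = n.
Proof.
move=> nf [kx [ky fn]]; rewrite /min_wavevector; case: ex_minnP => m.
move=> /asboolP[kx' [ky' <-]] mmin; apply/eqP; rewrite eqn_leq nf andbT.
by apply: leq_trans fn; apply: mmin; apply/asboolP; exists kx, ky.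
Qed.

Local Notation c_u := (ord0 : 'I_3).
Local Notation c_v := (lift ord0 ord0 : 'I_3).
Local Notation c_p := (lift ord0 (lift ord0 ord0) : 'I_3).

Lemma component_cases (c : 'I_3) : [\/ c = c_u, c = c_v | c = c_p].
Proof.
by case: c => [[|[|[|//]]] ?]; [apply: Or31|apply: Or32|apply: Or33]; apply: val_inj.
Qed.

(** In each direction the fluxes couple the pressure with the normal velocity only, and the upwind
    matrix damps exactly these two. *)
Lemma acoustic_rows (R : realType) (a b : R[i]) (cx sx cy sy : 'I_3 -> R[i]) :
  let row c := \sum_d (a * ((acoustic_Jx R c d)%:C * cx d + (upwind_Dx R c d)%:C * sx d)
   + b * ((acoustic_Jy R c d)%:C * cy d + (upwind_Dy R c d)%:C * sy d)) in
  [/\ row c_u = a * (cx c_p + sx c_u), row c_v = b * (cy c_p + sy c_v)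
    & row c_p = a * (cx c_u + sx c_p) + b * (cy c_v + sy c_p)].
Proof.
by split; rewrite !big_ord_recl big_ord0 !mxE /= ?(mulr0n, mulr1n, rmorph0, rmorph1); ring.
Qed.

Lemma dof_component_eq0 (F : fieldType) K (x : 'rV[F]_#|dof K 3|) :
  dof_component x c_u = 0 -> dof_component x c_v = 0 -> dof_component x c_p = 0 ->
  x = 0.
Proof.
move=> U V P; apply/rowP => s; rewrite -[s]enum_valK [RHS]mxE.
case: (enum_val s) => [[i j] c].
have -> : x 0 (enum_rank (i, j, c)) = dof_component x c i j by rewrite mxE.
by case: (component_cases c) => ->; rewrite ?U ?V ?P mxE.
Qed.

Lemma dg_steadyP (R : realType) K (K4 : (K < 4)%N) (dx dy kx ky : R)
    (x : 'rV[R[i]]_#|dof K 3|) : dx != 0 -> dy != 0 ->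
  x *m (dg_upwind_acoustics K dx dy kx ky)^T = 0 <->
  acoustic_steady (dg_deriv R K) (dg_right R K) (dg_left R K)
    (dx^-1)%:C (dy^-1)%:C (expi (kx * dx)) (expi (ky * dy))
    (dof_component x c_u) (dof_component x c_v) (dof_component x c_p).
Proof.
move=> dx0 dy0; rewrite /dg_upwind_acoustics /acoustic_steady.
have rowE k l c := mulmx_evolution (acoustic_Jx R) (acoustic_Jy R) (upwind_Dx R)
  (upwind_Dy R) K4 kx ky x k l c dx0 dy0.
move: rowE; cbv zeta.
move: (central _ _ _ (expi (kx * dx))) (central _ _ _ (expi (ky * dy))) => Cx Cy.
move: (dissip _ _ (expi (kx * dx))) (dissip _ _ (expi (ky * dy))) => Sx Sy.
move: (dof_component x) => X; move: (x *m _) => y yE.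
have [rU rV rP] : [/\ forall k l, y 0 (enum_rank (k, l, c_u))
      = ((dx^-1)%:C *: (Cx *m X c_p + Sx *m X c_u)) k l,
    forall k l, y 0 (enum_rank (k, l, c_v))
      = ((dy^-1)%:C *: (X c_p *m Cy^T + X c_v *m Sy^T)) k l
  & forall k l, y 0 (enum_rank (k, l, c_p))
      = ((dx^-1)%:C *: (Cx *m X c_u + Sx *m X c_p)
         + (dy^-1)%:C *: (X c_v *m Cy^T + X c_p *m Sy^T)) k l].
  split=> k l; rewrite yE; have [rU rV rP] := acoustic_rows (dx^-1)%:C (dy^-1)%:C
    (fun d => (Cx *m X d) k l) (fun d => (Sx *m X d) k l)
    (fun d => (X d *m Cy^T) k l) (fun d => (X d *m Sy^T) k l).
  - by rewrite rU [RHS]mxE [in RHS]mxE.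
  - by rewrite rV [RHS]mxE [in RHS]mxE.
  - rewrite rP [RHS]mxE.
    by congr (_ + _); rewrite [RHS]mxE; congr (_ * _); rewrite [RHS]mxE.
split=> [y0 | [eU eV eP]].
  by split; apply/matrixP => k l; rewrite -?rU -?rV -?rP y0 !mxE.
apply/rowP => s; rewrite -[s]enum_valK [RHS]mxE.
case: (enum_val s) => [[k l] c].
by case: (component_cases c) => ->; rewrite ?rU ?rV ?rP ?eU ?eV ?eP mxE.
Qed.

Section KernelDimension.
Variables (R : realType) (K : nat) (dx dy kx ky : R).
Hypotheses (K4 : (K < 4)%N) (hdx : 0 < dx) (hdy : 0 < dy).
Local Notation C := R[i].
Let a : C := (dx^-1)%:C.
Let b : C := (dy^-1)%:C.
Let tx : C := expi (kx * dx).
Let ty : C := expi (ky * dy).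
Let D := dg_deriv R K.

Let a0 : 0 < a. Proof. by rewrite ltcR invr_gt0. Qed.
Let b0 : 0 < b. Proof. by rewrite ltcR invr_gt0. Qed.

Let dx0 : dx != 0. Proof. by rewrite gt_eqF. Qed.
Let dy0 : dy != 0. Proof. by rewrite gt_eqF. Qed.

Lemma dof_componentP c : linear (fun x : 'rV[C]_#|dof K 3| => dof_component x c).
Proof. by move=> z u v; apply/matrixP => i j; rewrite !mxE. Qed.

Let div (x : 'rV[C]_#|dof K 3|) : 'M[C]_K.+1 :=
  a *: (D *m dof_component x c_u) + b *: (dof_component x c_v *m D^T).

Let divP : linear div.
Proof.
move=> z u v; rewrite /div !dof_componentP.
rewrite mulmxDr mulmxDl -scalemxAr -scalemxAl !scalerDr !scalerA.
by rewrite ![z * _]mulrC addrACA.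
Qed.

(** The last two components hold every entry of the divergence except the one at [(K, K)]. *)
Let constraints (x : 'rV[C]_#|dof K 3|) :
    'M[C]_K.+1 * 'rV[C]_K.+1 * 'cV[C]_K.+1 * 'M[C]_(K.+1, K) * 'cV[C]_K :=
  (dof_component x c_p,
   jump (dg_right R K) (dg_left R K) tx *m dof_component x c_u,
   dof_component x c_v *m (jump (dg_right R K) (dg_left R K) ty)^T,
   colsub (widen_ord (leqnSn K)) (div x),
   rowsub (widen_ord (leqnSn K)) (col ord_max (div x))).

Let constraints_linear : linear constraints.
Proof.
move=> z u v; rewrite /constraints divP !dof_componentP.
move: (jump _ _ tx) (jump _ _ ty)^T => jx jy; move: (div u) (div v) => Wu Wv.
rewrite mulmxDr mulmxDl -scalemxAr -scalemxAl.
by congr (_, _, _, _, _); apply/matrixP => i j; rewrite !mxE.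
Qed.

Lemma dim_ker_dg_ge : (K ^ 2 <= dim_ker (dg_upwind_acoustics K dx dy kx ky))%N.
Proof.
pose f : {linear _ -> _} := HB.pack constraints
  (GRing.isLinear.Build _ _ _ _ _ constraints_linear).
have := @kermx_rank_ge _ _ (dg_upwind_acoustics K dx dy kx ky)^T _ f.
have -> : dim ('M[C]_K.+1 * 'rV[C]_K.+1 * 'cV[C]_K.+1 * 'M[C]_(K.+1, K) * 'cV[C]_K)%type
  = (K.+1 * K.+1 + 1 * K.+1 + K.+1 * 1 + K.+1 * K + K * 1)%N by [].
(* The unknowns number [3 * (K + 1)^2]; subtracting the equations leaves [K^2]. *)
have -> : (#|dof K 3| - (K.+1 * K.+1 + 1 * K.+1 + K.+1 * 1 + K.+1 * K + K * 1) = K ^ 2)%N.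
  by rewrite card_dof; case: K K4 => [|[|[|[|]]]].
apply=> x [P0 jU jV W1 W2]; apply/(dg_steadyP K4 kx ky x dx0 dy0).
exact: (steady_of_constraints (dg_deriv_parts R K) (dg_deriv_real R K)
  (dg_right_real R K) (dg_left_real R K) (@dg_deriv_upper R K K4)
  (expi_unimodular _) (expi_unimodular _) a0 b0 P0 jU jV W1 W2).
Qed.

Let corner (x : 'rV[C]_#|dof K 3|) : 'M[C]_(K, K) :=
  mxsub (widen_ord (leqnSn K)) (widen_ord (leqnSn K)) (D *m dof_component x c_u).

Let corner_linear : linear corner.
Proof.
move=> z u v; rewrite /corner dof_componentP mulmxDr -scalemxAr.
move: (D *m _) (D *m _) => Wu Wv.
by apply/matrixP => i j; rewrite !mxE.
Qed.

Lemma dim_ker_dg_le : tx != 1 -> ty != 1 ->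
  (dim_ker (dg_upwind_acoustics K dx dy kx ky) <= K ^ 2)%N.
Proof.
move=> tx1 ty1.
pose f : {linear _ -> _} := HB.pack corner
  (GRing.isLinear.Build _ _ _ _ _ corner_linear).
rewrite -mulnn.
apply: (@kermx_rank_le _ _ (dg_upwind_acoustics K dx dy kx ky)^T _ f) => x.
move=> /(dg_steadyP K4 kx ky x dx0 dy0) st cx.
have [] := steady_corner_eq0 (dg_deriv_parts R K) (dg_deriv_real R K)
  (dg_right_real R K) (dg_left_real R K) (@dg_deriv_upper R K K4)
  (@dg_deriv_superdiag R K K4) (dg_right0 R K) (dg_left0 R K)
  (expi_unimodular _) (expi_unimodular _) a0 b0 tx1 ty1 st cx.
exact: dof_component_eq0.
Qed.
End KernelDimension.

Lemma min_dim_ker_dg (R : realType) K (dx dy : R) : (K < 4)%N -> 0 < dx -> 0 < dy ->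
  min_wavevector
    (fun kx ky : R => dim_ker (dg_upwind_acoustics K dx dy kx ky)) = (K ^ 2)%N.
Proof.
move=> K4 hdx hdy; apply: min_wavevector_eq => [kx ky|]; first exact: dim_ker_dg_ge.
(* The wave number [pi / h] gives the Bloch factor -1. *)
have neq1 h : 0 < h -> expi (pi / h * h) != 1 :> R[i].
  move=> h0; rewrite divfK ?(gt_eqF h0) // /expi cospi.
  by apply/eqP => /(congr1 (@complex.Re R)) /=; lra.
by exists (pi / dx), (pi / dy); apply: dim_ker_dg_le => //; exact: neq1.
Qed.

Lemma min_dim_ker_acoustic (R : realType) :
  min_wavevector
    (fun kx ky : R => dim_ker (kx *: acoustic_Jx R + ky *: acoustic_Jy R)) = 1%N.
Proof.
have mulE kx ky (x : 'rV[R]_3) :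
    x *m (kx *: acoustic_Jx R + ky *: acoustic_Jy R)^T
    = \row_j [:: kx * x 0 c_p; ky * x 0 c_p; kx * x 0 c_u + ky * x 0 c_v]`_j.
  apply/rowP => j; rewrite !mxE !big_ord_recl big_ord0 !mxE.
  by case: (component_cases j) => -> /=; ring.
apply: min_wavevector_eq => [kx ky|].
  (* Zero divergence and zero pressure are two equations in three unknowns. *)
  pose g (x : 'rV[R]_3) : R^o * R^o := (kx * x 0 c_u + ky * x 0 c_v, x 0 c_p).
  have glin : linear g.
    by move=> z u v; congr (_, _); rewrite /= !mxE /GRing.scale /=; ring.
  pose f : {linear _ -> _} := HB.pack g (GRing.isLinear.Build _ _ _ _ _ glin).
  apply: (@kermx_rank_ge _ _ (kx *: acoustic_Jx R + ky *: acoustic_Jy R)^T _ f).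
  move=> x [g1 g2]; rewrite mulE g1 g2 !mulr0.
  by apply/rowP => j; rewrite !mxE; case: (component_cases j) => ->.
(* For waves along x, stationarity forces [u] and [p] to vanish, so [v] is a coordinate on the
   kernel. *)
exists 1, 0.
pose g (x : 'rV[R]_3) : R^o := x 0 c_v.
have glin : linear g by move=> z u v; rewrite /g !mxE.
pose f : {linear _ -> _} := HB.pack g (GRing.isLinear.Build _ _ _ _ _ glin).
apply: (@kermx_rank_le _ _ (1 *: acoustic_Jx R + 0 *: acoustic_Jy R)^T _ f) => x.
rewrite mulE => /rowP x0 xv; apply/rowP => j; rewrite [RHS]mxE.
have := x0 c_u; have := x0 c_p; rewrite !mxE /= !mul0r !mul1r addr0 => xu xp.
by case: (component_cases j) => ->.
Qed.

Theorem mainTheorem2 (R : realType) (K : nat) (hK : (1 <= K <= 3)%N)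
    (dx dy : R) (hdx : 0 < dx) (hdy : 0 < dy) :
  min_wavevector
    (fun kx ky : R => dim_ker (dg_upwind_acoustics K dx dy kx ky)) = (K ^ 2)%N
  /\ stationarity_preserving (acoustic_Jx R) (acoustic_Jy R) (K.+1 ^ 2)%N
       (dg_upwind_acoustics K dx dy).
Proof.
have /andP[K0 K3] := hK.
rewrite /stationarity_preserving min_dim_ker_dg // min_dim_ker_acoustic.
by do 2!split=> //; rewrite expn_gt0 K0 leq_exp2r ?leqnSn.
Qed.
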